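(* Let $m\ge1$ (general vectorial case) and let $p^\pm:\mathbb{R}\times\overline{\Omega}\to\mathbb{R}^m$ be two classical solutions of (E) satisfying $$\inf\{|p^-(t,x)-p^+(t,x)|;\ (t,x)\in\mathbb{R}\times\overline{\Omega}\}>0.$$ Let $u$ be a generalized transition wave connecting $p^-$ and $p^+$ with a choice of associated sets $(\Omega^\pm_t)_{t\in\mathbb{R}}$ and $(\Gamma_t)_{t\in\mathbb{R}}$ satisfying (G1), (G2) and (G3). If $u$ has global mean speed $c$ (with respect to these sets), then, for any other choice of sets $(\tilde\Omega^\pm_t)_{t\in\mathbb{R}}$ and $(\tilde\Gamma_t)_{t\in\mathbb{R}}$ satisfying (G1), (G2) and (G3) and associated to $u$ as a transition wave connecting $p^-$ and $p^+$, $u$ has a global mean speed with respect to the sets $(\tilde\Omega^\pm_t)_{t\in\mathbb{R}}$, $(\tilde\Gamma_t)_{t\in\mathbb{R}}$, and this global mean speed is equal to $c$.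
   Context: Domain. $\Omega\subset\mathbb{R}^N$ ($N\ge1$) is a non-empty open connected set with outward unit normal $\nu$, globally smooth in the following sense: there exist $\beta>0$, $r_0>0$, $M>0$ such that for all $y\in\partial\Omega$ there are a rotation $R_y$ of $\mathbb{R}^N$ and a $C^{2,\beta}$ map $\phi_y:\overline{B}^{N-1}_{2r_0}\to\mathbb{R}$ with $\phi_y(0)=0$, $\|\phi_y\|_{C^{2,\beta}}\le M$ and $$\Omega\cap B(y,r_0)=\big[y+R_y(\{x\in\mathbb{R}^N;\ (x_1,\ldots,x_{N-1})\in\overline{B}^{N-1}_{2r_0},\ \phi_y(x_1,\ldots,x_{N-1})<x_N\})\big]\cap B(y,r_0),$$ where $B(y,r_0)$ is the open Euclidean ball and $\overline{B}^{N-1}_s$ is the closed ball of $\mathbb{R}^{N-1}$ with center $0$ and radius $s$ ($\Omega=\mathbb{R}^N$ is allowed). Geodesic distance. $d_\Omega(x,y)$ is the infimum of the arc lengths of all $C^1$ curves joining $x$ to $y$ in $\overline{\Omega}$; $d_\Omega(A,B)=\inf\{d_\Omega(x,y);\ x\in A,\ y\in B\}$, $d_\Omega(x,B)=d_\Omega(\{x\},B)$; $S_\Omega(x,r)=\{y\in\overline{\Omega};\ d_\Omega(x,y)=r\}$. It is assumed that $\Omega$ has infinite diameter for $d_\Omega$. Equation (E), with unknown $u=(u_1,\ldots,u_m):\mathbb{R}\times\overline{\Omega}\to\mathbb{R}^m$: $$u_t=\nabla_x\cdot(A(t,x)\nabla_xu)+q(t,x)\cdot\nabla_xu+f(t,x,u)\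 \text{in }\Omega,\qquad g[t,x,u]=0\ \text{on }\partial\Omega,\qquad t\in\mathbb{R}.$$ $A=(a_{ij})$ is a matrix field of class $C^{1,\beta}(\mathbb{R}\times\overline{\Omega})$ with $\alpha_1|\xi|^2\le \sum_{i,j}a_{ij}(t,x)\xi_i\xi_j\le\alpha_2|\xi|^2$ for some constants $0<\alpha_1\le\alpha_2$ and all $(t,x)\in\mathbb{R}\times\overline{\Omega}$, $\xi\in\mathbb{R}^N$; $q:\mathbb{R}\times\overline{\Omega}\to\mathbb{R}^N$ is of class $C^{0,\beta}(\mathbb{R}\times\overline{\Omega})$; $f:\mathbb{R}\times\overline{\Omega}\times\mathbb{R}^m\to\mathbb{R}^m$ is $C^{0,\beta}$ in $(t,x)$ locally in $u$, and locally Lipschitz-continuous in $u$ uniformly with respect to $(t,x)$. The boundary condition $g[t,x,u]=0$ is an arbitrary given one (it may be of Dirichlet, Neumann, Robin, tangential, nonlinear or heterogeneous type, and may involve $u$ and its derivatives). Geometric conditions. $(\Omega^-_t)_{t\in\mathbb{R}}$ and $(\Omega^+_t)_{t\in\mathbb{R}}$ are families of open nonempty unbounded (for $d_\Omega$) subsets of $\Omega$. (G1) For all $t$: $\Omega^-_t\cap\Omega^+_t=\emptyset$; $\partial\Omega^-_t\cap\Omega=\partial\Omega^+_t\cap\Omega=:\Gamma_t$; $\Omega^-_t\cup\Gamma_t\cup\Omega^+_t=\Omega$; $\sup\{d_\Omega(x,\Gamma_t);x\in\Omega^+_t\}=\sup\{d_\Omega(x,\Gamma_t);x\in\Omega^-_t\}=+\infty$.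 (G2) For each sign $\pm$, $\inf\big\{\sup\{d_\Omega(y,\Gamma_t);\ y\in\overline{\Omega^\pm_t}\cap S_\Omega(x,r)\};\ t\in\mathbb{R},\ x\in\Gamma_t\big\}\to+\infty$ as $r\to+\infty$. (G3) If $N\ge2$, there is an integer $n\ge1$ such that for each $t\in\mathbb{R}$ there are $n$ open sets $\omega_{i,t}\subset\mathbb{R}^{N-1}$, $n$ continuous maps $\psi_{i,t}:\omega_{i,t}\to\mathbb{R}$ and $n$ rotations $R_{i,t}$ of $\mathbb{R}^N$ ($1\le i\le n$) with $\Gamma_t\subset\bigcup_{1\le i\le n}R_{i,t}(\{x\in\mathbb{R}^N;\ (x_1,\ldots,x_{N-1})\in\omega_{i,t},\ x_N=\psi_{i,t}(x_1,\ldots,x_{N-1})\})$. If $N=1$, there is an integer $n\ge 1$ such that every $\Gamma_t$ has at most $n$ points. Generalized transition wave. Given two classical solutions $p^-,p^+$ of (E) on $\mathbb{R}\times\overline{\Omega}$, a generalized transition wave connecting $p^-$ and $p^+$ is a time-global (defined for all $t\in\mathbb{R}$) classical solution $u$ of (E) with $u\not\equiv p^\pm$ for which there exist sets $(\Omega^\pm_t)_{t\in\mathbb{R}}$, $(\Gamma_t)_{t\in\mathbb{R}}$ satisfying (G1), (G2), (G3) (the associated sets) such that for every $\epsilon>0$ there is $M$ such that, for each sign $\pm$, all $t\in\mathbb{R}$ and all $x\in\overline{\Omega^\pm_t}$: $d_\Omega(x,\Gamma_t)\ge M$ implies $|u(t,x)-p^\pm(t,x)|\le\epsilon$. Global mean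 speed. A generalized transition wave $u$ with associated sets $(\Omega^\pm_t)_{t\in\mathbb{R}}$, $(\Gamma_t)_{t\in\mathbb{R}}$ has global mean speed $c\ge0$ (with respect to these sets) if $d_\Omega(\Gamma_t,\Gamma_s)/|t-s|\to c$ as $|t-s|\to+\infty$. *)

(* Defs.v *)
From HB Require Import structures.
From mathcomp Require Import all_boot all_order all_algebra.
From mathcomp Require Import all_classical all_reals all_analysis.
Import Order.TTheory GRing.Theory Num.Theory.
Import numFieldNormedType.Exports.
Set Implicit Arguments.
Unset Strict Implicit.
Unset Printing Implicit Defensive.
Local Open Scope classical_set_scope.
Local Open Scope ring_scope.

(* The space R^N, N >= 1, is 'rV[R]_n.+1 with N = n.+1, and points (t, x) of
   space-time are elements of R * 'rV[R]_n.+1.  Functions on R x closure Omega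
   are total functions, of which only the values on that set matter. *)

(* Euclidean norm; the library norm on 'rV[R]_n is the maximum norm. *)
Definition enorm (R : realType) (n : nat) (x : 'rV[R]_n) : R :=
  Num.sqrt (\sum_(i < n) x 0 i ^+ 2).

Definition eball (R : realType) (n : nat) (y : 'rV[R]_n) (r : R) :
    set 'rV[R]_n :=
  [set x | enorm (x - y) < r].

Definition boundary (T : topologicalType) (A : set T) : set T :=
  closure A `\` interior A.

(* In dimension 1 the reflection -1 is included, so that both left and right
   half-lines are smooth domains. *)
Definition rotation (R : realType) (n : nat) (Q : 'M[R]_n) : Prop :=
  Q *m Q^T = 1%:M /\ ((1 < n)%N -> \det Q = 1).

(* (x_1, ..., x_(N-1)) and x_N, for x in R^N. *)
Definition xprime (R : realType) (n : nat) (x : 'rV[R]_n.+1) : 'rV[R]_n :=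
  col' ord_max x.
Definition xlast (R : realType) (n : nat) (x : 'rV[R]_n.+1) : R := x 0 ord_max.

(* For D open: all the partial derivatives of f of order at most k in the
   directions dirs exist and are continuous in D. *)
Fixpoint class_C (R : realType) (V W : normedModType R) (k : nat)
    (dirs : seq V) (D : set V) (f : V -> W) : Prop :=
  {within D, continuous f} /\
  match k with
  | 0%N => True
  | k'.+1 => forall v, v \in dirs ->
      (forall z, D z -> derivable f z v) /\ class_C k' dirs D ('D_v f)
  end.

Definition sup_norm (R : realType) (V W : normedModType R) (D : set V)
    (f : V -> W) : \bar R :=
  ereal_sup [set (`|f z|)%:E | z in D].

(* Pairs with z.1 = z.2 contribute 0 / 0 = 0. *)
Definition holder_seminorm (R : realType) (V W : normedModType R) (beta : R)
    (D : set V) (f : V -> W) : \bar R :=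
  ereal_sup
    [set (`|f z.1 - f z.2| / `|z.1 - z.2| `^ beta)%:E | z in D `*` D].

(* The C^(k,beta) norm over D.  It is computed with the library norms of V and
   W (maximum norms), hence equals the Euclidean one up to constants depending
   only on the dimensions. *)
Fixpoint holder_norm (R : realType) (V W : normedModType R) (k : nat)
    (dirs : seq V) (beta : R) (D : set V) (f : V -> W) : \bar R :=
  (sup_norm D f +
  match k with
  | 0%N => holder_seminorm beta D f
  | k'.+1 => \sum_(v <- dirs) holder_norm k' dirs beta D ('D_v f)
  end)%E.

(* For D open: f is of class C^(k,beta) on closure D, with norm at most M.  The
   Holder bounds provide the continuous extension of the derivatives of f to
   closure D, so these are only considered in D. *)
Definition holder_le (R : realType) (V W : normedModType R) (k : nat)
    (dirs : seq V) (beta : R) (D : set V) (M : R) (f : V -> W) : Prop :=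
  [/\ class_C k dirs D f, {within closure D, continuous f} &
      (holder_norm k dirs beta D f <= M%:E)%E].

Definition holder (R : realType) (V W : normedModType R) (k : nat)
    (dirs : seq V) (beta : R) (D : set V) (f : V -> W) : Prop :=
  exists M : R, holder_le k dirs beta D M f.

Definition dirs_coord (R : realType) (n : nat) : seq 'rV[R]_n :=
  [seq delta_mx 0 i | i <- enum 'I_n].
Definition dirt (R : realType) (n : nat) : R * 'rV[R]_n := (1, 0).
Definition dirx (R : realType) (n : nat) (i : 'I_n) : R * 'rV[R]_n :=
  (0, delta_mx 0 i).
Definition dirsx (R : realType) (n : nat) : seq (R * 'rV[R]_n) :=
  [seq dirx R i | i <- enum 'I_n].
Definition dirstx (R : realType) (n : nat) : seq (R * 'rV[R]_n) :=
  dirt R n :: dirsx R n.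

Definition smooth_domain (R : realType) (n : nat) (beta : R)
    (Omega : set 'rV[R]_n.+1) : Prop :=
  exists r0 M : R, [/\ 0 < r0, 0 < M &
    forall y, boundary Omega y ->
      exists (Q : 'M[R]_n.+1) (phi : 'rV[R]_n -> R),
        [/\ rotation Q, phi 0 = 0,
            holder_le 2 (dirs_coord R n) beta (eball 0 (2 * r0)) M phi &
            Omega `&` eball y r0 =
            [set y + x *m Q | x in [set x | enorm (xprime x) <= 2 * r0 /\
                                            phi (xprime x) < xlast x]]
            `&` eball y r0]].

(* A C^1 curve on [0, 1] is the restriction of a C^1 curve defined on R. *)
Definition C1_curve (R : realType) (n : nat) (Omega : set 'rV[R]_n)
    (x y : 'rV[R]_n) (gamma : R -> 'rV[R]_n) : Prop :=
  [/\ forall s, derivable gamma s 1, continuous (derive1 gamma),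
      gamma 0 = x, gamma 1 = y &
      forall s, 0 <= s <= 1 -> closure Omega (gamma s)].

Definition arc_length (R : realType) (n : nat) (gamma : R -> 'rV[R]_n) :
    \bar R :=
  (\int[lebesgue_measure]_(s in `[0%R, 1%R]) (enorm (derive1 gamma s))%:E)%E.

(* Distances are extended reals, with value +oo when no curve exists. *)
Definition geodist (R : realType) (n : nat) (Omega : set 'rV[R]_n)
    (x y : 'rV[R]_n) : \bar R :=
  ereal_inf [set arc_length gamma | gamma in C1_curve Omega x y].

Definition geodist_sets (R : realType) (n : nat) (Omega A B : set 'rV[R]_n) :
    \bar R :=
  ereal_inf [set geodist Omega z.1 z.2 | z in A `*` B].

Definition geodist_set (R : realType) (n : nat) (Omega : set 'rV[R]_n)
    (x : 'rV[R]_n) (B : set 'rV[R]_n) : \bar R :=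
  geodist_sets Omega [set x] B.

Definition geosphere (R : realType) (n : nat) (Omega : set 'rV[R]_n)
    (x : 'rV[R]_n) (r : R) : set 'rV[R]_n :=
  [set y | closure Omega y /\ geodist Omega x y = r%:E].

Definition geounbounded (R : realType) (n : nat) (Omega A : set 'rV[R]_n) :
    Prop :=
  ereal_sup [set geodist Omega z.1 z.2 | z in A `*` A] = +oo%E.

Definition elliptic (R : realType) (n : nat) (Omega : set 'rV[R]_n)
    (A : R * 'rV[R]_n -> 'M[R]_n) : Prop :=
  exists alpha1 alpha2 : R, [/\ 0 < alpha1, alpha1 <= alpha2 &
    forall t x (xi : 'rV[R]_n), closure Omega x ->
      alpha1 * enorm xi ^+ 2
        <= \sum_(i < n) \sum_(j < n) A (t, x) i j * xi 0 i * xi 0 j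
        <= alpha2 * enorm xi ^+ 2].

Definition holder_locally_in_u (R : realType) (n m : nat) (beta : R)
    (Omega : set 'rV[R]_n) (f : R * 'rV[R]_n -> 'rV[R]_m -> 'rV[R]_m) : Prop :=
  forall K : R, exists M : R, forall s, enorm s <= K ->
    holder_le 0 (dirstx R n) beta (setT `*` Omega) M (f ^~ s).

Definition locally_lipschitz_in_u (R : realType) (n m : nat)
    (Omega : set 'rV[R]_n) (f : R * 'rV[R]_n -> 'rV[R]_m -> 'rV[R]_m) : Prop :=
  forall K : R, exists L : R, forall t x s s', closure Omega x ->
    enorm s <= K -> enorm s' <= K ->
    enorm (f (t, x) s - f (t, x) s') <= L * enorm (s - s').

(* g (t, x) u stands for g[t,x,u]: an arbitrary operator acting on functions u
   defined on R x closure Omega, i.e. insensitive to the values of u elsewhere. *)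
Definition boundary_operator (R : realType) (n m k : nat)
    (Omega : set 'rV[R]_n)
    (g : R * 'rV[R]_n -> (R * 'rV[R]_n -> 'rV[R]_m) -> 'rV[R]_k) : Prop :=
  forall u v, (forall t x, closure Omega x -> u (t, x) = v (t, x)) ->
    forall t x, boundary Omega x -> g (t, x) u = g (t, x) v.

Definition classical_solution (R : realType) (n m k : nat)
    (Omega : set 'rV[R]_n) (A : R * 'rV[R]_n -> 'M[R]_n)
    (q : R * 'rV[R]_n -> 'rV[R]_n)
    (f : R * 'rV[R]_n -> 'rV[R]_m -> 'rV[R]_m)
    (g : R * 'rV[R]_n -> (R * 'rV[R]_n -> 'rV[R]_m) -> 'rV[R]_k)
    (u : R * 'rV[R]_n -> 'rV[R]_m) : Prop :=
  [/\ {within setT `*` closure Omega, continuous u},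
      class_C 1 [:: dirt R n] (setT `*` Omega) u /\
      class_C 2 (dirsx R n) (setT `*` Omega) u,
      forall t x, Omega x ->
        'D_(dirt R n) u (t, x) =
          \sum_(i < n) 'D_(dirx R i)
             (fun w => \sum_(j < n) A w i j *: 'D_(dirx R j) u w) (t, x)
          + \sum_(i < n) q (t, x) 0 i *: 'D_(dirx R i) u (t, x)
          + f (t, x) (u (t, x)) &
      forall t x, boundary Omega x -> g (t, x) u = 0].

Definition family_of_open_sets (R : realType) (n : nat)
    (Omega : set 'rV[R]_n) (O : R -> set 'rV[R]_n) : Prop :=
  forall t, [/\ open (O t), O t !=set0, O t `<=` Omega &
                geounbounded Omega (O t)].

Definition condG1 (R : realType) (n : nat) (Omega : set 'rV[R]_n)
    (Om Op Gamma : R -> set 'rV[R]_n) : Prop :=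
  forall t,
    [/\ Om t `&` Op t = set0,
        boundary (Om t) `&` Omega = Gamma t /\
        boundary (Op t) `&` Omega = Gamma t,
        Om t `|` Gamma t `|` Op t = Omega,
        ereal_sup [set geodist_set Omega x (Gamma t) | x in Op t] = +oo%E &
        ereal_sup [set geodist_set Omega x (Gamma t) | x in Om t] = +oo%E].

(* To be required of both families O = Om and O = Op. *)
Definition condG2_half (R : realType) (n : nat) (Omega : set 'rV[R]_n)
    (O Gamma : R -> set 'rV[R]_n) : Prop :=
  ereal_inf
    [set ereal_sup [set geodist_set Omega y (Gamma z.1)
                   | y in closure (O z.1) `&` geosphere Omega z.2 r]
    | z in [set z : R * 'rV[R]_n | Gamma z.1 z.2]]
  @[r --> +oo%R] --> +oo%E.

Definition condG2 (R : realType) (n : nat) (Omega : set 'rV[R]_n)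
    (Om Op Gamma : R -> set 'rV[R]_n) : Prop :=
  condG2_half Omega Om Gamma /\ condG2_half Omega Op Gamma.

Definition condG3 (R : realType) (n : nat) (Gamma : R -> set 'rV[R]_n.+1) :
    Prop :=
  exists2 k : nat, (1 <= k)%N &
  forall t,
    if (0 < n)%N then
      exists (omega : 'I_k -> set 'rV[R]_n) (psi : 'I_k -> 'rV[R]_n -> R)
             (Q : 'I_k -> 'M[R]_n.+1),
        (forall i, [/\ open (omega i), {within omega i, continuous (psi i)} &
                       rotation (Q i)]) /\
        Gamma t `<=` \bigcup_i
          [set x *m Q i | x in [set x | omega i (xprime x) /\
                                        xlast x = psi i (xprime x)]]
    else (Gamma t #<= `I_k)%card.

Definition admissible_sets (R : realType) (n : nat)
    (Omega : set 'rV[R]_n.+1) (Om Op Gamma : R -> set 'rV[R]_n.+1) : Prop :=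
  [/\ family_of_open_sets Omega Om, family_of_open_sets Omega Op,
      condG1 Omega Om Op Gamma, condG2 Omega Om Op Gamma & condG3 Gamma].

Definition converges_away (R : realType) (n m : nat)
    (Omega : set 'rV[R]_n.+1) (pm pp u : R * 'rV[R]_n.+1 -> 'rV[R]_m)
    (Om Op Gamma : R -> set 'rV[R]_n.+1) : Prop :=
  forall eps : R, 0 < eps -> exists M : R, forall t x,
    (M%:E <= geodist_set Omega x (Gamma t))%E ->
    (closure (Om t) x -> enorm (u (t, x) - pm (t, x)) <= eps) /\
    (closure (Op t) x -> enorm (u (t, x) - pp (t, x)) <= eps).

(* The sets are associated to u as a wave connecting pm and pp. *)
Definition associated_sets (R : realType) (n m : nat)
    (Omega : set 'rV[R]_n.+1) (pm pp u : R * 'rV[R]_n.+1 -> 'rV[R]_m)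
    (Om Op Gamma : R -> set 'rV[R]_n.+1) : Prop :=
  admissible_sets Omega Om Op Gamma /\
  converges_away Omega pm pp u Om Op Gamma.

Definition transition_wave (R : realType) (n m k : nat)
    (Omega : set 'rV[R]_n.+1) (A : R * 'rV[R]_n.+1 -> 'M[R]_n.+1)
    (q : R * 'rV[R]_n.+1 -> 'rV[R]_n.+1)
    (f : R * 'rV[R]_n.+1 -> 'rV[R]_m -> 'rV[R]_m)
    (g : R * 'rV[R]_n.+1 -> (R * 'rV[R]_n.+1 -> 'rV[R]_m) -> 'rV[R]_k)
    (pm pp u : R * 'rV[R]_n.+1 -> 'rV[R]_m) : Prop :=
  [/\ classical_solution Omega A q f g u,
      exists t x, closure Omega x /\ u (t, x) <> pm (t, x),
      exists t x, closure Omega x /\ u (t, x) <> pp (t, x) &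
      exists Om Op Gamma, associated_sets Omega pm pp u Om Op Gamma].

Definition global_mean_speed (R : realType) (n : nat) (Omega : set 'rV[R]_n)
    (Gamma : R -> set 'rV[R]_n) (c : R) : Prop :=
  0 <= c /\
  forall eps : R, 0 < eps -> exists T : R, forall t s, T <= `|t - s| ->
    (`|geodist_sets Omega (Gamma t) (Gamma s) * (`|t - s|^-1)%:E - c%:E|
       <= eps%:E)%E.

(* Main.v *)
Require Import Defs.
From mathcomp Require Import all_boot all_order all_algebra.
From mathcomp Require Import all_classical all_reals all_analysis.
From mathcomp Require Import ring lra.
Import Order.TTheory GRing.Theory Num.Theory.
Import numFieldNormedType.Exports.
Local Open Scope classical_set_scope.
Local Open Scope ring_scope.

Set Implicit Arguments.
Unset Strict Implicit.
Unset Printing Implicit Defensive.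

(** The gap between the two limiting states makes any two choices of interfaces
    for the same wave stay within a bounded distance of each other, uniformly in
    time; the distances between interfaces at two times then differ by a bounded
    amount, which is negligible after division by |t - s|.

    For the uniform bound ([interface_near]), let x lie on the second interface
    at time t.  By (G2) for the second family there are, for some radius r not
    depending on (t, x), points y- and y+ at distance r from x at which u is
    close to p- and to p+.  Suppose that x is at distance more than M + r + 1
    from the first interface, where M is the convergence distance of the first
    family.  Then on the whole ball of radius r + 1 around x, u is close to p-
    on closure Omega- and close to p+ on closure Omega+, Omega- and Omega+ being
    the two sides of that interface.  Since p- and p+ are a fixed distance
    apart, y- lies in closure Omega- and y+ in closure Omega+, and no point of
    the ball lies in both.  But x is in one of these two closed sets, which
    cover closure Omega, and an almost minimal curve from x to y- or to y+,
    whichever lies in the other set, stays in the ball; by connectedness it has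
    a point in both sets, a contradiction.

    This uses that the geodesic distance is a pseudo-distance
    ([geodist_triangle], [geodist_sym]) and that the points of a curve issued
    from x are no further from x than its length ([geodist_prefix]).  Since
    admissible curves are C^1, the concatenation of two of them must be
    reparametrized so as to stop at the junction.  All these length computations
    go through a primitive of the speed: the length of a curve is an increment
    of that primitive, and the chain rule then replaces changes of variables in
    the integral. *)

(** * Euclidean norm *)

Lemma enorm_ge0 (R : realType) (n : nat) (x : 'rV[R]_n) : 0 <= enorm x.
Proof. exact: sqrtr_ge0. Qed.

Lemma enorm_sqr (R : realType) (n : nat) (x : 'rV[R]_n) :
  enorm x ^+ 2 = \sum_(i < n) x 0 i ^+ 2.
Proof. by rewrite sqr_sqrtr// sumr_ge0// => i _; exact: sqr_ge0. Qed.

Lemma enormZ (R : realType) (n : nat) (a : R) (x : 'rV[R]_n) :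
  enorm (a *: x) = `|a| * enorm x.
Proof.
rewrite /enorm -sqrtr_sqr -sqrtrM ?sqr_ge0//; congr Num.sqrt.
by rewrite mulr_sumr; apply: eq_bigr => i _; rewrite mxE exprMn.
Qed.

(** The parallelogram inequality stands in for the triangle inequality. *)
Lemma enormB_sqr_le (R : realType) (n : nat) (x y : 'rV[R]_n) :
  enorm (x - y) ^+ 2 <= 2 * (enorm x ^+ 2 + enorm y ^+ 2).
Proof.
rewrite !enorm_sqr -big_split mulr_sumr; apply: ler_sum => i _ /=.
rewrite !mxE; have := sqr_ge0 (x 0 i + y 0 i); nra.
Qed.

Lemma continuous_enorm (R : realType) (n : nat) : continuous (@enorm R n).
Proof.
move=> x; apply: (@continuous_comp _ _ _
    (fun x : 'rV[R]_n => \sum_(i < n) x 0 i ^+ 2)).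
  apply: continuous_big => [|i _ {}x]; first exact: add_continuous.
  have -> : (fun x : 'rV[R]_n => x 0 i ^+ 2) = (fun x => x 0 i * x 0 i).
    by apply/funext => y; rewrite expr2.
  by apply: continuousM; exact: coord_continuous.
exact: sqrt_continuous.
Qed.

(** * Speed primitives and arc length *)

Lemma is_derive_compZ (R : realType) (V : normedModType R) (g : R -> V)
    (h : R -> R) (s dh : R) (dg : V) :
  is_derive (h s) 1 g dg -> is_derive s 1 h dh ->
  is_derive s 1 (g \o h) (dh *: dg).
Proof.
move=> [gd <-] [hd <-].
have /derivable1_diffP gd' := gd; have /derivable1_diffP hd' := hd.
apply: DeriveDef; first exact/derivable1_diffP/differentiable_comp.
rewrite deriveE; last exact: differentiable_comp.
rewrite diff_comp// /= -(deriveE _ hd') diff1E// derive1E.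
by [].
Qed.

Lemma is_derive_continuous (R : realType) (V : normedModType R) (g : R -> V)
    (s : R) (dg : V) : is_derive s 1 g dg -> {for s, continuous g}.
Proof.
by move=> [gd _]; exact/differentiable_continuous/derivable1_diffP.
Qed.

(** Two-sided derivatives are required at the endpoints too, so that composing
    with a function valued in [0, 1] can be done by the chain rule. *)
Definition speed_primitive (R : realType) (n : nat) (gamma : R -> 'rV[R]_n)
    (F : R -> R) : Prop :=
  forall s : R, 0 <= s <= 1 -> is_derive s 1 F (enorm (gamma^`()%classic s)).

Lemma speed_continuous (R : realType) (n : nat) (gamma : R -> 'rV[R]_n) :
  continuous gamma^`()%classic ->
  continuous (fun s => enorm (gamma^`()%classic s)).
Proof.
by move=> cg s; apply: continuous_comp; [exact: cg|exact: continuous_enorm].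
Qed.

(** The fundamental theorem of calculus, the speed being continuous. *)
Lemma arc_length_primitive (R : realType) (n : nat) (gamma : R -> 'rV[R]_n)
    (F : R -> R) :
  continuous gamma^`()%classic -> speed_primitive gamma F ->
  arc_length gamma = (F 1 - F 0)%:E.
Proof.
move=> cg dF; rewrite EFinB; apply: continuous_FTC2 => //.
- by apply: continuous_subspaceT; exact: speed_continuous.
- split.
  + move=> s; rewrite in_itv/= => /andP[s0 s1].
    by have [] : is_derive s 1 F (enorm (gamma^`()%classic s))
      by apply: dF; rewrite !ltW.
  + apply: cvg_at_right_filter.
    by apply: is_derive_continuous; apply: dF; rewrite lexx ler01.
  + apply: cvg_at_left_filter.
    by apply: is_derive_continuous; apply: dF; rewrite lexx ler01.
- move=> s; rewrite in_itv/= => /andP[s0 s1].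
  rewrite derive1E; apply: derive_val.
  by apply: dF; rewrite !ltW.
Qed.

Lemma speed_primitive_exists (R : realType) (n : nat) (gamma : R -> 'rV[R]_n) :
  continuous gamma^`()%classic -> exists F, speed_primitive gamma F.
Proof.
move=> cg; have cs := speed_continuous cg.
pose f s := enorm (gamma^`()%classic s).
(* The base point -1 and the integration bound 2 make 0 and 1 interior
   points. *)
exists (fun x => \int[lebesgue_measure]_(t in `[(-1 : R), x]) f t)%R.
move=> s /andP[s0 s1].
have [||||dF F'] := @continuous_FTC1_closed R f (-1) s 2.
- lra.
- apply: continuous_compact_integrable; first exact: segment_compact.
  exact: continuous_subspaceT.
- lra.
- exact: cs.
by apply: DeriveDef; [exact: dF|rewrite -derive1E; exact: F'].
Qed.

Lemma speed_primitive_homo (R : realType) (n : nat) (gamma : R -> 'rV[R]_n)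
    F s t :
  speed_primitive gamma F -> 0 <= s -> s <= t -> t <= 1 -> F s <= F t.
Proof.
move=> dF s0 st t1; apply: (@ger0_derive1_le_cc R F 0 1) => //.
- move=> x; rewrite in_itv/= => /andP[x0 x1].
  by have [] : is_derive x 1 F (enorm (gamma^`()%classic x))
    by apply: dF; rewrite !ltW.
- move=> x; rewrite in_itv/= => /andP[x0 x1].
  have Fx : is_derive x 1 F (enorm (gamma^`()%classic x))
    by apply: dF; rewrite !ltW.
  by rewrite derive1E derive_val enorm_ge0.
- apply: derivable_within_continuous => x; rewrite in_itv/= => x01.
  by have [] := dF _ x01.
- by rewrite in_itv/=; apply/andP; split => //; exact: le_trans t1.
- by rewrite in_itv/= t1 (le_trans s0).
Qed.

(** * Calculus of continuously differentiable functions *)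

(** The derivative is carried along, so that the velocity of a curve built by
    the rules below is known by construction. *)
Definition C1_with (R : realType) (V : normedModType R) (g dg : R -> V) :
    Prop :=
  (forall s : R, is_derive s 1 g (dg s)) /\ continuous dg.

Lemma C1_with_cst (R : realType) (V : normedModType R) (a : V) :
  C1_with (fun _ : R => a) (fun _ : R => 0).
Proof. by split=> s; [exact: is_derive_cst|exact: cvg_cst]. Qed.

Lemma C1_with_ext (R : realType) (V : normedModType R) (f df g dg : R -> V) :
  C1_with f df -> f =1 g -> df =1 dg -> C1_with g dg.
Proof. by move=> C /funext <- /funext <-. Qed.

Lemma C1_withD (R : realType) (V : normedModType R) (f g df dg : R -> V) :
  C1_with f df -> C1_with g dg ->
  C1_with (fun s => f s + g s) (fun s => df s + dg s).
Proof.
move=> [fD cf] [gD cg]; split=> s; first exact: (is_deriveD (fD s) (gD s)).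
exact: (cvgD (cf s) (cg s)).
Qed.

Lemma C1_with_comp (R : realType) (V : normedModType R) (g dg : R -> V)
    (h dh : R -> R) :
  C1_with g dg -> C1_with h dh ->
  C1_with (fun s => g (h s)) (fun s => dh s *: dg (h s)).
Proof.
move=> [gD cg] [hD ch]; split=> s; first exact: (is_derive_compZ (gD _) (hD s)).
apply: (cvgZ (ch s)).
by apply: continuous_comp; [exact: is_derive_continuous|exact: cg].
Qed.

Lemma C1_with_affine (R : realType) (a b : R) :
  C1_with (fun s : R => a * s + b) (fun _ : R => a).
Proof.
split=> s; last exact: cvg_cst.
have h := is_deriveD (is_deriveZ a (is_derive_id s (1 : R)))
  (is_derive_cst b s (1 : R)).
by apply: is_derive_eq (h) _; rewrite addr0 [LHS]mulr1.
Qed.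

Lemma C1_with_curve (R : realType) (n : nat) (Omega : set 'rV[R]_n) x y g :
  C1_curve Omega x y g -> C1_with g g^`()%classic.
Proof.
by move=> [gD cg _ _ _]; split=> // s; apply: DeriveDef; rewrite ?derive1E.
Qed.

Lemma C1_with_derive1 (R : realType) (V : normedModType R) (g dg : R -> V) :
  C1_with g dg -> g^`()%classic = dg.
Proof.
by move=> [gD _]; apply/funext => s; rewrite derive1E; exact: derive_val.
Qed.

Lemma C1_curve_with (R : realType) (n : nat) (Omega : set 'rV[R]_n) x y g dg :
  C1_with g dg -> g 0 = x -> g 1 = y ->
  (forall s, 0 <= s <= 1 -> closure Omega (g s)) -> C1_curve Omega x y g.
Proof.
move=> gC g0 g1 cO; split => //; last by rewrite (C1_with_derive1 gC); case: gC.
by move=> s; case: gC => /(_ s)[].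
Qed.

(** * Geodesic distance: positivity, symmetry, initial arcs *)

(** Any primitive F of the speed of a curve can be used to bound the distance
    between its endpoints, which avoids computing an integral. *)
Lemma geodist_le (R : realType) (n : nat) (Omega : set 'rV[R]_n) x y g dg F :
  C1_with g dg -> g 0 = x -> g 1 = y ->
  (forall s, 0 <= s <= 1 -> closure Omega (g s)) ->
  (forall s : R, 0 <= s <= 1 -> is_derive s 1 F (enorm (dg s))) ->
  (geodist Omega x y <= (F 1 - F 0)%:E)%E.
Proof.
move=> gC g0 g1 cO dF; apply: ereal_inf_lbound => /=.
exists g; first exact: C1_curve_with gC g0 g1 cO.
apply: arc_length_primitive; rewrite /speed_primitive (C1_with_derive1 gC) //.
by case: gC.
Qed.

Lemma is_derive_speed (R : realType) (n : nat) (g : R -> 'rV[R]_n) F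
    (h : R -> R) (s dh : R) :
  speed_primitive g F -> 0 <= h s <= 1 -> is_derive s 1 h dh ->
  is_derive s 1 (fun t => F (h t)) (dh * enorm (g^`()%classic (h s))).
Proof. by move=> dF hs hD; exact: (is_derive_compZ (dF _ hs) hD). Qed.

Lemma geodist_ge0 (R : realType) (n : nat) (Omega : set 'rV[R]_n) x y :
  (0 <= geodist Omega x y)%E.
Proof.
apply: le_ereal_inf_tmp => _ [g _ <-].
by apply: integral_ge0 => s _; rewrite lee_fin enorm_ge0.
Qed.

(** The initial arc is the curve t |-> g (s * t), with speed primitive
    t |-> F (s * t); it is no longer than g because F is nondecreasing. *)
Lemma geodist_prefix (R : realType) (n : nat) (Omega : set 'rV[R]_n) x y g s :
  C1_curve Omega x y g -> 0 <= s <= 1 ->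
  (geodist Omega x (g s) <= arc_length g)%E.
Proof.
move=> gC /andP[s0 s1]; have gC1 := C1_with_curve gC.
case: gC => [_ cg g0 g1 cO].
have [F dF] := speed_primitive_exists cg.
rewrite (arc_length_primitive cg dF)//.
have ss t : 0 <= t <= 1 -> 0 <= s * t + 0 <= 1.
  by move=> /andP[t0 t1]; rewrite addr0 mulr_ge0//= mulr_ile1.
have aff := C1_with_affine s 0.
apply: (@le_trans _ _ (F (s * 1 + 0) - F (s * 0 + 0))%:E).
  apply: (geodist_le (F := (fun t => F (s * t + 0))) (C1_with_comp gC1 aff)).
  - by rewrite mulr0 addr0.
  - by rewrite mulr1 addr0.
  - by move=> t t01; apply: cO; exact: ss.
  - move=> t t01; rewrite enormZ ger0_norm//.
    exact: (is_derive_speed (h := fun t => s * t + 0) dF (ss _ t01) (aff.1 t)).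
rewrite mulr1 mulr0 !addr0 lee_fin lerD2r.
by apply: (speed_primitive_homo dF).
Qed.

(** The reversed curve t |-> g (1 - t) has t |-> - F (1 - t) as a speed
    primitive. *)
Lemma geodist_sym_le (R : realType) (n : nat) (Omega : set 'rV[R]_n) x y :
  (geodist Omega y x <= geodist Omega x y)%E.
Proof.
apply: le_ereal_inf_tmp => _ [g gC <-]; have gC1 := C1_with_curve gC.
case: gC => [_ cg g0 g1 cO].
have [F dF] := speed_primitive_exists cg.
rewrite (arc_length_primitive cg dF)//.
have ss (t : R) : 0 <= t <= 1 -> 0 <= -1 * t + 1 <= 1 by lra.
have aff := C1_with_affine (-1) 1 : C1_with (fun s : R => -1 * s + 1) _.
have -> : F 1 - F 0 = - F (-1 * 1 + 1) - - F (-1 * 0 + 1).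
  by rewrite mulr0 add0r mulr1 addNr opprK addrC.
apply: (geodist_le (F := (fun t => - F (-1 * t + 1))) (C1_with_comp gC1 aff)).
- by rewrite mulr0 add0r.
- by rewrite mulr1 addNr.
- by move=> t t01; apply: cO; exact: ss.
- move=> t t01; rewrite enormZ normrN normr1 mul1r.
  have h := is_deriveN
    (is_derive_speed (h := fun t => -1 * t + 1) dF (ss _ t01) (aff.1 t)).
  by apply: is_derive_eq h _; rewrite -mulNr opprK mul1r.
Qed.

Lemma geodist_sym (R : realType) (n : nat) (Omega : set 'rV[R]_n) x y :
  geodist Omega x y = geodist Omega y x.
Proof. by apply/eqP; rewrite eq_le !geodist_sym_le. Qed.

(** * Concatenation of curves and the triangle inequality *)

Definition pos_part (R : realType) (s : R) : R := Num.max 0 s.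

(** The remainder of the first-order expansion of the squared positive part is
    at most quadratic; this one estimate gives the derivative at every point,
    the origin included. *)
Lemma C1_with_pos_part_sqr (R : realType) :
  C1_with (fun s : R => pos_part s ^+ 2) (fun s => 2 * pos_part s).
Proof.
have bound (s h : R) :
    `|pos_part (s + h) ^+ 2 - pos_part s ^+ 2 - 2 * pos_part s * h| <= h ^+ 2.
  rewrite /pos_part ler_norml /Num.max.
  case: ifPn; rewrite -?leNgt => H1; case: ifPn; rewrite -?leNgt => H2; nra.
split=> s; last first.
  apply: cvgM; first exact: cvg_cst.
  apply: (@continuous_max R _ (fun _ => 0) id); first exact: cvg_cst.
  exact: cvg_id.
have lim : h^-1 *: (pos_part (h *: 1 + s) ^+ 2 - pos_part s ^+ 2)
    @[h --> (0 : R)^'] --> 2 * pos_part s.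
  apply/cvgrPdist_le => e e0; near=> h.
  have h0 : h != 0 by near: h; exact: nbhs_dnbhs_neq.
  have he : `|h| <= e by near: h; exact: dnbhs0_le.
  apply: le_trans he; rewrite distrC /GRing.scale /= mulr1 (addrC h).
  have hp : 0 < `|h| by rewrite normr_gt0.
  rewrite -(ler_pM2r hp) -normrM -expr2 real_normK ?num_real//.
  have -> : (h^-1 * (pos_part (s + h) ^+ 2 - pos_part s ^+ 2)
      - 2 * pos_part s) * h =
      pos_part (s + h) ^+ 2 - pos_part s ^+ 2 - 2 * pos_part s * h.
    by field.
  exact: bound.
apply: DeriveDef; last exact: cvg_lim lim.
by apply/cvg_ex; exists (2 * pos_part s).
Unshelve. all: by end_near. Qed.

(** The C^1 quadratic spline with knots 0, 1/2 and 1, equal to 0 before 0 and to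
    1 after 1. *)
Definition smooth_step (R : realType) (s : R) : R :=
  2 * pos_part s ^+ 2 - 4 * pos_part (s - 2^-1) ^+ 2
  + 2 * pos_part (s - 1) ^+ 2.

Definition smooth_step' (R : realType) (s : R) : R :=
  4 * pos_part s - 8 * pos_part (s - 2^-1) + 4 * pos_part (s - 1).

Lemma C1_with_smooth_step (R : realType) :
  C1_with (@smooth_step R) (@smooth_step' R).
Proof.
have sc (a b : R) : C1_with (fun s => a * pos_part (s + b) ^+ 2)
    (fun s => 2 * a * pos_part (s + b)).
  have C := C1_with_comp (C1_with_affine a 0)
    (C1_with_comp (C1_with_pos_part_sqr R) (C1_with_affine 1 b)).
  by apply: C1_with_ext C _ _ => s;
    rewrite mul1r ?addr0//= /GRing.scale/=; ring.
have C := C1_withD (C1_withD (sc 2 0) (sc (- 4) (- 2^-1))) (sc 2 (-1)).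
apply: C1_with_ext C _ _ => s;
  by rewrite /smooth_step /smooth_step' !addr0; ring.
Qed.

Lemma smooth_step_le0 (R : realType) (s : R) : s <= 0 ->
  smooth_step s = 0 /\ smooth_step' s = 0.
Proof.
move=> s0; rewrite /smooth_step /smooth_step' /pos_part.
by rewrite !max_l; [split; ring|lra..].
Qed.

Lemma smooth_step_ge1 (R : realType) (s : R) : 1 <= s ->
  smooth_step s = 1 /\ smooth_step' s = 0.
Proof.
move=> s1; rewrite /smooth_step /smooth_step' /pos_part.
by rewrite !max_r; [split; field|lra..].
Qed.

Lemma smooth_step_itv (R : realType) (s : R) : 0 <= smooth_step s <= 1.
Proof.
rewrite /smooth_step /pos_part /Num.max.
by case: ifPn; rewrite -?leNgt => H1; case: ifPn; rewrite -?leNgt => H2;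
  case: ifPn; rewrite -?leNgt => H3; nra.
Qed.

Lemma smooth_step'_ge0 (R : realType) (s : R) : 0 <= smooth_step' s.
Proof.
rewrite /smooth_step' /pos_part /Num.max.
by case: ifPn; rewrite -?leNgt => H1; case: ifPn; rewrite -?leNgt => H2;
  case: ifPn; rewrite -?leNgt => H3; lra.
Qed.

(** The two curves are run one after the other by
    s |-> g1 (step (2 s)) + g2 (step (2 s - 1)) - y.
    On each half of [0, 1] one of the two terms is frozen at the junction y, with
    zero velocity, so that the sum is C^1 and the speeds add up. *)
Lemma geodist_concat (R : realType) (n : nat) (Omega : set 'rV[R]_n)
    x y z g1 g2 :
  C1_curve Omega x y g1 -> C1_curve Omega y z g2 ->
  (geodist Omega x z <= arc_length g1 + arc_length g2)%E.
Proof.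
move=> g1C g2C; have g1C1 := C1_with_curve g1C; have g2C1 := C1_with_curve g2C.
case: g1C => [_ cg1 g10 g11 cO1]; case: g2C => [_ cg2 g20 g21 cO2].
have [F1 dF1] := speed_primitive_exists cg1.
have [F2 dF2] := speed_primitive_exists cg2.
rewrite (arc_length_primitive cg1 dF1) (arc_length_primitive cg2 dF2).
have [st0 _] := smooth_step_le0 (lexx (0 : R)).
have [st1 _] := smooth_step_ge1 (lexx (1 : R)).
pose h1 (s : R) := smooth_step (2 * s + 0).
pose dh1 (s : R) := 2 * smooth_step' (2 * s + 0).
pose h2 (s : R) := smooth_step (2 * s + -1).
pose dh2 (s : R) := 2 * smooth_step' (2 * s + -1).
have h1C : C1_with h1 dh1 :=
  C1_with_comp (C1_with_smooth_step R) (C1_with_affine 2 0).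
have h2C : C1_with h2 dh2 :=
  C1_with_comp (C1_with_smooth_step R) (C1_with_affine 2 (-1)).
have h10 : h1 0 = 0 by rewrite /h1 mulr0 addr0.
have h11 : h1 1 = 1 by have [] : _ := @smooth_step_ge1 R (2 * 1 + 0) ltac:(lra).
have h20 : h2 0 = 0
  by have [] : _ := @smooth_step_le0 R (2 * 0 + -1) ltac:(lra).
have h21 : h2 1 = 1 by rewrite /h2 (_ : 2 * 1 + -1 = 1)//; ring.
pose g s := g1 (h1 s) + g2 (h2 s) + - y.
pose dg s :=
  dh1 s *: g1^`()%classic (h1 s) + dh2 s *: g2^`()%classic (h2 s) + 0.
have gC : C1_with g dg.
  exact: (C1_withD (C1_withD (C1_with_comp g1C1 h1C) (C1_with_comp g2C1 h2C))
    (C1_with_cst (- y))).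
pose F s := F1 (h1 s) + F2 (h2 s).
have -> : (F1 1 - F1 0)%:E + (F2 1 - F2 0)%:E = (F 1 - F 0)%:E :> \bar R.
  by rewrite /F h10 h11 h20 h21 -EFinD; congr EFin; ring.
apply: (geodist_le gC).
- by rewrite /g h10 h20 g10 g20 addrK.
- by rewrite /g h11 h21 g11 g21 addrAC subrr add0r.
- move=> s _; rewrite /g; have [s2|s2] := leP s 2^-1.
    have -> : h2 s = 0 by apply: (smooth_step_le0 _).1; lra.
    by rewrite g20 addrK; apply: cO1; exact: smooth_step_itv.
  have -> : h1 s = 1 by apply: (smooth_step_ge1 _).1; lra.
  by rewrite g11 addrAC subrr add0r; apply: cO2; exact: smooth_step_itv.
- move=> s _.
  have D1 := is_derive_speed (h := h1) dF1 (smooth_step_itv _) (h1C.1 s).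
  have D2 := is_derive_speed (h := h2) dF2 (smooth_step_itv _) (h2C.1 s).
  apply: is_derive_eq (is_deriveD D1 D2) _.
  have dh1_ge0 : 0 <= dh1 s by rewrite mulr_ge0// smooth_step'_ge0.
  have dh2_ge0 : 0 <= dh2 s by rewrite mulr_ge0// smooth_step'_ge0.
  have [s2|s2] := leP s 2^-1.
    have dh0 : dh2 s = 0 by rewrite /dh2 (smooth_step_le0 _).2 ?mulr0//; lra.
    by rewrite [dg s]addr0 dh0 scale0r mul0r !addr0 enormZ ger0_norm.
  have dh0 : dh1 s = 0 by rewrite /dh1 (smooth_step_ge1 _).2 ?mulr0//; lra.
  by rewrite [dg s]addr0 dh0 scale0r mul0r !add0r enormZ ger0_norm.
Qed.

Lemma geodist_triangle (R : realType) (n : nat) (Omega : set 'rV[R]_n) y x z :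
  (geodist Omega x z <= geodist Omega x y + geodist Omega y z)%E.
Proof.
have [xy|] := boolP (geodist Omega x y \is a fin_num); last first.
  rewrite ge0_fin_numE ?geodist_ge0// -leNgt leye_eq => /eqP ->.
  by rewrite addye ?leey// gt_eqF// (lt_le_trans _ (geodist_ge0 _ _ _)) ?ltNy0.
have [yz|] := boolP (geodist Omega y z \is a fin_num); last first.
  rewrite ge0_fin_numE ?geodist_ge0// -leNgt leye_eq => /eqP ->.
  by rewrite addey ?leey// gt_eqF// (lt_le_trans _ (geodist_ge0 _ _ _)) ?ltNy0.
apply/lee_addgt0Pr => e e0; have e2 : 0 < e / 2 by rewrite divr_gt0.
have [_ [g1 g1C <-] l1] := lb_ereal_inf_adherent e2 xy.
have [_ [g2 g2C <-] l2] := lb_ereal_inf_adherent e2 yz.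
apply: (le_trans (geodist_concat g1C g2C)).
apply: (le_trans (leeD (ltW l1) (ltW l2))).
by rewrite addeACA -EFinD -splitr.
Qed.

(** * Geodesic distance to sets *)

Lemma closed_cover_meet (R : realType) (T : topologicalType) (A B : set T)
    (g : R -> T) :
  continuous g -> closed A -> closed B ->
  (forall s, 0 <= s <= 1 -> (A `|` B) (g s)) -> A (g 0) -> B (g 1) ->
  exists2 s, 0 <= s <= 1 & (A `&` B) (g s).
Proof.
move=> cg cA cB AB A0 B1; apply: contrapT => noAB.
have nAB s : 0 <= s <= 1 -> A (g s) -> ~ B (g s).
  by move=> s01 As Bs; apply: noAB; exists s.
pose S := `[0%R, 1%R]%classic `&` g @^-1` A.
have : S = `[0%R, 1%R]%classic.
  apply: (@segment_connected R 0 1).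
  - by exists 0; split => //=; rewrite in_itv/= lexx ler01.
  - exists (g @^-1` (~` B)).
      by apply: open_comp; [move=> ? _; exact: cg|exact: closed_openC].
    apply/seteqP; split=> s [s01 /= h]; split => //=;
      move: s01; rewrite /= in_itv/= => s01; first exact: nAB.
    by case: (AB s s01).
  - by exists (g @^-1` A) => //; apply: closed_comp => // ? _; exact: cg.
move=> SE; have : S 1 by rewrite SE /= in_itv/= ler01 lexx.
by move=> [_ /= A1]; apply: (nAB 1) => //; rewrite ler01 lexx.
Qed.

(** A curve of length less than r from A to B stays at distance less than r from
    x, and by connectedness it has a point in both sets. *)
Lemma geodist_separation (R : realType) (n : nat) (Omega A B : set 'rV[R]_n)
    x y (r : R) :
  closed A -> closed B -> closure Omega `<=` A `|` B ->
  A x -> B y -> (geodist Omega x y < r%:E)%E ->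
  exists z, [/\ closure Omega z, A z, B z & (geodist Omega x z < r%:E)%E].
Proof.
move=> cA cB cAB Ax By /ereal_inf_lt[_ [g gC <-] lr].
have [gD _ g0 g1 cO] := gC.
have cg : continuous g.
  by move=> s; apply/differentiable_continuous/derivable1_diffP.
have gAB s (s01 : 0 <= s <= 1) : (A `|` B) (g s) by exact/cAB/cO.
rewrite -g0 in Ax; rewrite -g1 in By.
have [s s01 [As Bs]] := closed_cover_meet cg cA cB gAB Ax By.
exists (g s); split => //; first exact: cO.
exact: le_lt_trans (geodist_prefix gC s01) lr.
Qed.

Lemma geodist_set_le (R : realType) (n : nat) (Omega : set 'rV[R]_n) x z B :
  (geodist_set Omega x B <= geodist Omega x z + geodist_set Omega z B)%E.
Proof.
have [xz|] := boolP (geodist Omega x z \is a fin_num); last first.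
  rewrite ge0_fin_numE ?geodist_ge0// -leNgt leye_eq => /eqP ->.
  rewrite addye ?leey// gt_eqF// (lt_le_trans (ltNyr 0))//.
  by apply: le_ereal_inf_tmp => _ [p _ <-]; exact: geodist_ge0.
rewrite -leeBlDl//; apply: le_ereal_inf_tmp => _ [[z' w] [/= -> Bw] <-].
rewrite leeBlDl//; apply: le_trans (geodist_triangle _ z _ _).
by apply: ereal_inf_lbound; exists (x, w).
Qed.

(** A curve from A' to B' is extended at both ends by curves of length about
    C. *)
Lemma geodist_sets_perturb (R : realType) (n : nat)
    (Omega A B A' B' : set 'rV[R]_n) (C : R) :
  (forall x, A' x -> (geodist_set Omega x A <= C%:E)%E) ->
  (forall x, B' x -> (geodist_set Omega x B <= C%:E)%E) ->
  (geodist_sets Omega A B <= geodist_sets Omega A' B' + (2 * C)%:E)%E.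
Proof.
move=> AC BC.
rewrite -leeBlDr//; apply: le_ereal_inf_tmp => _ [[x y] [/= A'x B'y] <-].
rewrite EFinN leeBlDr//; apply/lee_addgt0Pr => e e0.
have lt_near S z : (geodist_set Omega z S <= C%:E)%E ->
    exists2 w, S w & (geodist Omega z w < (C + e / 2)%:E)%E.
  move=> zS; have : (geodist_set Omega z S < (C + e / 2)%:E)%E.
    by apply: le_lt_trans zS _; rewrite lte_fin ltrDl divr_gt0.
  by move=> /ereal_inf_lt[_ [[z' w] [/= -> Sw] <-] /=]; exists w.
have [v Av xv] := lt_near _ _ (AC _ A'x).
have [w Bw yw] := lt_near _ _ (BC _ B'y).
apply: (@le_trans _ _ (geodist Omega v w)).
  by apply: ereal_inf_lbound; exists (v, w).
apply: (le_trans (geodist_triangle _ x _ _)).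
rewrite geodist_sym; apply: (le_trans (leeD2l _ (geodist_triangle _ y _ _))).
rewrite addeCA -addeA; apply: leeD2l.
apply: (le_trans (leeD (ltW xv) (ltW yw))).
by rewrite -!EFinD lee_fin; lra.
Qed.

(** * Comparison of interfaces *)

(** The bounded discrepancy C contributes at most C / |t - s| to the mean speed.
    The inequalities are between extended reals because a distance can be
    infinite; finiteness of one of the two forces that of the other. *)
Lemma global_mean_speed_transfer (R : realType) (n : nat)
    (Omega : set 'rV[R]_n) (Gamma Gamma' : R -> set 'rV[R]_n) (c C : R) :
  0 <= C ->
  (forall t s, (geodist_sets Omega (Gamma t) (Gamma s) <=
    geodist_sets Omega (Gamma' t) (Gamma' s) + C%:E)%E) ->
  (forall t s, (geodist_sets Omega (Gamma' t) (Gamma' s) <=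
    geodist_sets Omega (Gamma t) (Gamma s) + C%:E)%E) ->
  global_mean_speed Omega Gamma c -> global_mean_speed Omega Gamma' c.
Proof.
move=> C0 GG' G'G [c0 speed]; split=> // e e0.
have e2 : 0 < e / 2 by rewrite divr_gt0.
have [T HT] := speed _ e2.
(* The summand 1 keeps |t - s| away from 0. *)
exists (Num.max T (1 + C / (e / 2))) => t s; rewrite ge_max => /andP[Tts Cts].
have := HT t s Tts; have := GG' t s; have := G'G t s.
set d := geodist_sets _ (Gamma t) _; set d' := geodist_sets _ (Gamma' t) _.
set v := `|t - s| in Cts *.
have Ce0 : 0 <= C / (e / 2) by rewrite divr_ge0// ltW.
have v0 : 0 < v by lra.
have Cv : C * v^-1 <= e / 2.
  rewrite ler_pdivrMr// mulrC -ler_pdivrMr//; lra.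
(* An infinite d would make the bound on the mean speed of Gamma fail. *)
case: d => [d| |] /=; first 1 last.
- by move=> _ _; rewrite gt0_mulye ?lte_fin ?invr_gt0// addye// leye_eq.
- by move=> _ _; rewrite gt0_mulNye ?lte_fin ?invr_gt0// addNye leye_eq.
case: d' => [d'| |] //=; rewrite !lee_fin => h1 h2.
rewrite !ler_norml => /andP[h3 h4].
have i0 : 0 < v^-1 by rewrite invr_gt0.
have : d' * v^-1 <= (d + C) * v^-1 by rewrite ler_pM2r.
have : d * v^-1 <= (d' + C) * v^-1 by rewrite ler_pM2r.
rewrite !mulrDl => h5 h6; lra.
Qed.

Lemma closure_sides (R : realType) (n : nat)
    (Omega : set 'rV[R]_n) (Om Op Gamma : R -> set 'rV[R]_n) t :
  condG1 Omega Om Op Gamma ->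
  closure Omega `<=` closure (Om t) `|` closure (Op t).
Proof.
move=> /(_ t)[_ [<- _] <- _ _].
rewrite -closureU [X in _ `<=` X](iffLR (closure_id _));
  last exact: closed_closure.
apply: closure_subset => x [[Omx|[[Omx _] _]]|Opx].
- by apply: subset_closure; left.
- by apply: closure_subset Omx => z; left.
- by apply: subset_closure; right.
Qed.

Lemma condG2_half_far (R : realType) (n : nat) (Omega : set 'rV[R]_n)
    (O Gamma : R -> set 'rV[R]_n) (M : R) :
  condG2_half Omega O Gamma ->
  \forall r \near +oo%R, forall t x, Gamma t x ->
    exists y, [/\ closure (O t) y, closure Omega y, geodist Omega x y = r%:E &
                  (M%:E <= geodist_set Omega y (Gamma t))%E].
Proof.
move=> /cvgeyPgt/(_ M); apply: filterS => r /lt_le_trans lt t x xG.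
have /ereal_sup_gt[_ [y [Oy [cy xy]] <-] My] :
    (M%:E < ereal_sup [set geodist_set Omega y (Gamma t)
       | y in closure (O t) `&` geosphere Omega x r])%E.
  by apply: lt; apply: ereal_inf_lbound; exists (t, x).
by exists y; split => //; exact: ltW.
Qed.

(** Far from the first interface, u tells the two sides of that interface apart
    by the state it is close to; around a point of the second interface it is
    close to both states within a bounded distance, and going from one state to
    the other cannot avoid a point common to both closed sides. *)
Lemma interface_near (R : realType) (n m : nat) (Omega : set 'rV[R]_n.+1)
    (pm pp u : R * 'rV[R]_n.+1 -> 'rV[R]_m) (eta : R)
    (Om Op Gamma Om' Op' Gamma' : R -> set 'rV[R]_n.+1) :
  0 < eta ->
  (forall t x, closure Omega x -> eta <= enorm (pm (t, x) - pp (t, x))) ->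
  associated_sets Omega pm pp u Om Op Gamma ->
  associated_sets Omega pm pp u Om' Op' Gamma' ->
  exists C : R, forall t x, Gamma' t x ->
    (geodist_set Omega x (Gamma t) <= C%:E)%E.
Proof.
move=> eta0 gap [[_ _ G1 _ _] away] [[_ _ G1' [G2m G2p] _] away'].
(* With tolerance eta / 3, closeness to both states at one point would give
   eta ^ 2 <= 4 * (eta / 3) ^ 2 by enormB_sqr_le. *)
have e0 : 0 < eta / 3 by rewrite divr_gt0.
have [M HM] := away _ e0; have [M' HM'] := away' _ e0.
near (+oo%R : set_system R) => r.
have farm : forall t x, Gamma' t x -> exists y, [/\ closure (Om' t) y,
    closure Omega y, geodist Omega x y = r%:E &
    (M'%:E <= geodist_set Omega y (Gamma' t))%E].
  by near: r; exact: condG2_half_far G2m.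
have farp : forall t x, Gamma' t x -> exists y, [/\ closure (Op' t) y,
    closure Omega y, geodist Omega x y = r%:E &
    (M'%:E <= geodist_set Omega y (Gamma' t))%E].
  by near: r; exact: condG2_half_far G2p.
exists (M + (r + 1)) => t x xG'; rewrite leNgt; apply/negP => ltx.
have ball z : (geodist Omega x z < (r + 1)%:E)%E ->
    (M%:E <= geodist_set Omega z (Gamma t))%E.
  move=> xz; rewrite leNgt; apply/negP => zM.
  have := lt_trans ltx (le_lt_trans (geodist_set_le _ x z _) (lteD xz zM)).
  by rewrite -EFinD addrC ltxx.
have excl z : closure Omega z -> enorm (u (t, z) - pm (t, z)) <= eta / 3 ->
    enorm (u (t, z) - pp (t, z)) <= eta / 3 -> False.
  move=> cz zm zp; have := gap t z cz.
  have := enormB_sqr_le (u (t, z) - pp (t, z)) (u (t, z) - pm (t, z)).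
  rewrite opprB [_ + (pm _ - _)]addrC addrA subrK.
  have := enorm_ge0 (u (t, z) - pm (t, z)).
  have := enorm_ge0 (u (t, z) - pp (t, z)).
  nra.
have [ym [Oym cym xym Mym]] := farm _ _ xG'.
have [yp [Oyp cyp xyp Myp]] := farp _ _ xG'.
have rr : (r%:E < (r + 1)%:E)%E by rewrite lte_fin ltrDl.
have bm : (geodist Omega x ym < (r + 1)%:E)%E by rewrite xym.
have bp : (geodist Omega x yp < (r + 1)%:E)%E by rewrite xyp.
have cov := @closure_sides R n.+1 Omega Om Op Gamma t G1.
have Aym : closure (Om t) ym.
  case: (cov _ cym) => // Bym; exfalso; apply: (excl ym cym).
    exact: (HM' _ _ Mym).1.
  exact: (HM _ _ (ball _ bm)).2.
have Byp : closure (Op t) yp.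
  case: (cov _ cyp) => // Ayp; exfalso; apply: (excl yp cyp).
    exact: (HM _ _ (ball _ bp)).1.
  exact: (HM' _ _ Myp).2.
have cx : closure Omega x.
  by apply: subset_closure; have [_ _ <- _ _] := G1' t; left; right.
have cA := @closed_closure _ (Om t); have cB := @closed_closure _ (Op t).
have [z [cz Az Bz xz]] : exists z, [/\ closure Omega z, closure (Om t) z,
    closure (Op t) z & (geodist Omega x z < (r + 1)%:E)%E].
  case: (cov _ cx) => [Ax|Bx].
    exact: geodist_separation cA cB cov Ax Byp bp.
  have cov' : closure Omega `<=` closure (Op t) `|` closure (Om t)
    by rewrite setUC.
  have [z [? ? ? ?]] := geodist_separation cB cA cov' Bx Aym bm.
  by exists z.
have [am ap] := HM _ _ (ball _ xz).
exact: (excl z cz (am Az) (ap Bz)).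
Unshelve. all: by end_near. Qed.

(** An infinite infimum, which occurs when the index set is empty, leaves eta
    arbitrary. *)
Lemma gap_inf (R : realType) (n m : nat) (Omega : set 'rV[R]_n)
    (pm pp : R * 'rV[R]_n -> 'rV[R]_m) :
  (0 < ereal_inf [set (enorm (pm z - pp z))%:E
                 | z in setT `*` closure Omega])%E ->
  exists2 eta : R, 0 < eta &
    forall t x, closure Omega x -> eta <= enorm (pm (t, x) - pp (t, x)).
Proof.
set I := ereal_inf _ => I0.
have lb t x : closure Omega x -> (I <= (enorm (pm (t, x) - pp (t, x)))%:E)%E.
  by move=> cx; apply: ereal_inf_lbound; exists (t, x).
case: I I0 lb => [eta| |] // => [eta0|_] lb.
  by exists eta => // t x cx; rewrite -lee_fin; exact: lb.
by exists 1 => // t x cx; have := lb t x cx; rewrite leye_eq.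
Qed.

Unset Implicit Arguments.

Theorem theorem1p7 (R : realType) (n m k : nat) (hm : (1 <= m)%N)
    (beta : R) (hbeta : 0 < beta)
    (Omega : set 'rV[R]_n.+1)
    (hOmega_neq0 : Omega !=set0) (hOmega_open : open Omega)
    (hOmega_connected : connected Omega)
    (hOmega_smooth : smooth_domain beta Omega)
    (hOmega_diameter : geounbounded Omega Omega)
    (A : R * 'rV[R]_n.+1 -> 'M[R]_n.+1)
    (hA : holder 1 (dirstx R n.+1) beta (setT `*` Omega) A)
    (hA_elliptic : elliptic Omega A)
    (q : R * 'rV[R]_n.+1 -> 'rV[R]_n.+1)
    (hq : holder 0 (dirstx R n.+1) beta (setT `*` Omega) q)
    (f : R * 'rV[R]_n.+1 -> 'rV[R]_m -> 'rV[R]_m)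
    (hf_holder : holder_locally_in_u beta Omega f)
    (hf_lipschitz : locally_lipschitz_in_u Omega f)
    (g : R * 'rV[R]_n.+1 -> (R * 'rV[R]_n.+1 -> 'rV[R]_m) -> 'rV[R]_k)
    (hg : boundary_operator Omega g)
    (pm pp : R * 'rV[R]_n.+1 -> 'rV[R]_m)
    (hpm : classical_solution Omega A q f g pm)
    (hpp : classical_solution Omega A q f g pp)
    (hpmpp : (0 < ereal_inf [set (enorm (pm z - pp z))%:E
                            | z in setT `*` closure Omega])%E)
    (u : R * 'rV[R]_n.+1 -> 'rV[R]_m)
    (hu : transition_wave Omega A q f g pm pp u)
    (Om Op Gamma : R -> set 'rV[R]_n.+1)
    (hassoc : associated_sets Omega pm pp u Om Op Gamma)
    (c : R) (hc : global_mean_speed Omega Gamma c)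
    (Om' Op' Gamma' : R -> set 'rV[R]_n.+1)
    (hassoc' : associated_sets Omega pm pp u Om' Op' Gamma') :
  global_mean_speed Omega Gamma' c.
Proof.
have [eta eta0 gap] := gap_inf hpmpp.
have [C1 HC1] := interface_near eta0 gap hassoc hassoc'.
have [C2 HC2] := interface_near eta0 gap hassoc' hassoc.
pose C := Num.max 0 (Num.max C1 C2).
have C0 : 0 <= C by rewrite le_max lexx.
have G'G t x : Gamma' t x -> (geodist_set Omega x (Gamma t) <= C%:E)%E.
  by move=> /HC1 /le_trans; apply; rewrite lee_fin !le_max lexx orbT.
have GG' t x : Gamma t x -> (geodist_set Omega x (Gamma' t) <= C%:E)%E.
  by move=> /HC2 /le_trans; apply; rewrite lee_fin !le_max lexx !orbT.
apply: (@global_mean_speed_transfer R n.+1 Omega Gamma Gamma' c (2 * C)) =>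
  // [|t s|t s].
- exact: mulr_ge0.
- by apply: geodist_sets_perturb; exact: G'G.
- by apply: geodist_sets_perturb; exact: GG'.
Qed.
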